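(* The set $F_{\{0,1,2,3\}}$ of probability measures on $\mathbb{R}$ supported in $\{0,1,2,3\}$ is not good.
   Context: $P(\mathbb{R})$ denotes the set of Borel probability measures on $\mathbb{R}$, with the $\sigma$-algebra generated by the maps $\mu\mapsto\mu(B)$, $B\subset\mathbb{R}$ Borel; $P(P(\mathbb{R}))$ is the set of probability measures on $P(\mathbb{R})$. For $\Theta\in P(P(\mathbb{R}))$, a sequence $X=(X_j)_{j\in\mathbb{N}}$ of real random variables is iid-$\Theta$ if $\mathbb{P}(X\in B)=\int\theta^{\mathbb{N}}(B)\,d\Theta(\theta)$ for all Borel $B\subset\mathbb{R}^{\mathbb{N}}$, where $\theta^{\mathbb{N}}$ is the infinite product measure. A measurable set $L\subset P(\mathbb{R})$ is called good if the following holds: whenever $\Theta_1,\Theta_2\in P(P(\mathbb{R}))$ are concentrated on $L$, $X$ is iid-$\Theta_1$, $Y$ is iid-$\Theta_2$, and $\sum_{j=1}^n X_j$ and $\sum_{j=1}^n Y_j$ have the same distribution for every $n\ge 1$, then $\Theta_1=\Theta_2$. *)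

(* Defs.v *)
From HB Require Import structures.
From mathcomp Require Import all_boot all_order all_algebra.
From mathcomp Require Import all_classical all_reals all_analysis.
Set Implicit Arguments.
Unset Strict Implicit.
Unset Printing Implicit Defensive.
Import Order.TTheory GRing.Theory Num.Theory.
Import numFieldNormedType.Exports.
Local Open Scope classical_set_scope.
Local Open Scope ring_scope.
Local Open Scope ereal_scope.

(* The library's [pprobability T R] carries the sigma-algebra generated by the
   sets [mu U < r] with [U] measurable, i.e. by the evaluation maps. *)
Notation PR R := (pprobability R R).
Notation PPR R := (probability (PR R) R).

(* R^N with the Borel sigma-algebra of the product topology. *)
Definition realseq (R : realType) :
    measurableType (@open {ptws nat -> R}).-sigma :=
  g_sigma_algebraType (@open {ptws nat -> R}).

Definition is_power_measure (R : realType) (θ : PR R)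
    (nu : probability (realseq R) R) : Prop :=
  forall (n : nat) (B : nat -> set R), (forall i, measurable (B i)) ->
    nu [set x | forall i, (i < n)%N -> B i (x i)] = \prod_(i < n) θ (B i).

(* θ^N is the unique (on measurable sets) measure with
   [is_power_measure]; it exists by Kolmogorov's extension theorem, so the
   default value of [get] is never used. *)
Definition power_measure (R : realType) (θ : PR R) :
    probability (realseq R) R :=
  get [set nu | is_power_measure θ nu].

Definition iid_mixture (R : realType) (d : measure_display)
    (Omega : measurableType d) (P : probability Omega R)
    (Θ : PPR R) (X : nat -> {RV P >-> R}) : Prop :=
  forall B : set (realseq R), measurable B ->
    P [set w | B (fun j => X j w)] = \int[Θ]_θ (power_measure θ B).

(* Equality of measures is agreement on measurable sets: the library leaves the
   values of a measure on non-measurable sets unspecified, so Leibniz equality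
   of [Θ1] and [Θ2] would be too strong.  [L] is meant to be measurable, so that
   [Θ L = 1] says that Θ is concentrated on [L]. *)
Definition good (R : realType) (L : set (PR R)) : Prop :=
  forall Θ1 Θ2 : PPR R, Θ1 L = 1 -> Θ2 L = 1 ->
  forall (d1 d2 : measure_display)
    (Omega1 : measurableType d1) (Omega2 : measurableType d2)
    (P1 : probability Omega1 R) (P2 : probability Omega2 R)
    (X : nat -> {RV P1 >-> R}) (Y : nat -> {RV P2 >-> R}),
  iid_mixture Θ1 X -> iid_mixture Θ2 Y ->
  (forall n : nat, (1 <= n)%N -> forall B : set R, measurable B ->
    P1 [set w | B (\sum_(j < n) X j w)%R] =
    P2 [set w | B (\sum_(j < n) Y j w)%R]) ->
  forall A : set (PR R), measurable A -> Θ1 A = Θ2 A.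

Definition supported_in (R : realType) (A : set R) : set (PR R) :=
  [set θ | θ A = 1].

Definition F0123 (R : realType) : set (PR R) :=
  supported_in [set 0; 1; 2; 3]%R.
Arguments F0123 : clear implicits.

Lemma measurable_supported_in (R : realType) (A : set R) :
  measurable A -> measurable (supported_in A).
Proof.
move=> mA; rewrite (_ : supported_in A = ~` mset A 1%R).
  apply: measurableC; apply: sub_sigma_algebra; exists 1%R => /=.
    by rewrite in_itv/= ler01 lexx.
  by exists A.
apply/seteqP; split => th /=; rewrite /supported_in /mset /=.
  by move=> ->; rewrite ltxx.
by move=> /negP; rewrite -leNgt => h; apply/eqP; rewrite eq_le h probability_le1.
Qed.

Lemma measurable_F0123 (R : realType) : measurable (F0123 R).
Proof. by apply: measurable_supported_in; do ?apply: measurableU. Qed.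

(* Main.v *)
(* A point (a, b, c) of a small box encodes the law p on {0, 1, 2, 3} with
   generating polynomial p(z) = (1 + z + z^2 + z^3) / 4 + (z - 1) (a + b z + c z^2) / 16.
   The laws of all partial sums determine, and are determined by, the law of
   p(z) under Θ for every z, that is, the laws of the projections
   a + b z + c z^2 of (a, b, c).  The Fourier transform of a law on the box is
   thus only seen on the cone x1 x3 = x2^2, and two laws cannot be told apart if
   they differ by (d1 d3 - d2^2) φ.  For φ the product of the indicator of
   [0, 1], the tent function on [0, 2] and the indicator of [0, 1] this gives,
   with u, v independent and uniform on [0, 1]:
   - Θ1: (0, u + v, 0) and (1, u + v, 1), each with weight 1/4, and (u, 1, v)
     with weight 1/2;
   - Θ2: (0, u + v, 1), (1, u + v, 0), (u, 0, v) and (u, 2, v), each with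
     weight 1/4.
   An iid-Θ sequence is realized on P(R) x [0, 1] by expanding a uniform point
   in the mixed base given by the weights of θ. *)

Require Import Defs.
From HB Require Import structures.
From mathcomp Require Import all_boot all_order all_algebra.
From mathcomp Require Import all_classical all_reals all_analysis.
From mathcomp Require Import measurable_realfun ring lra.
Set Implicit Arguments.
Unset Strict Implicit.
Unset Printing Implicit Defensive.
Import Order.TTheory GRing.Theory Num.Theory.
Import numFieldNormedType.Exports.
Local Open Scope classical_set_scope.
Local Open Scope ring_scope.
Local Open Scope ereal_scope.

(** * Borel sets of the sequence space *)

Section cylinders.
Context (R : realType).

(** The finite-dimensional boxes, on which [is_power_measure] prescribes the values; they form a
    pi-system generating the Borel sets. *)
Definition cylinder : set (set (nat -> R)) :=
  [set C | exists n (B : nat -> set R), (forall i, measurable (B i)) /\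
    C = [set x | forall i, (i < n)%N -> B i (x i)]].

Lemma cylinderT : cylinder setT.
Proof.
exists 0%N, (fun=> setT); split=> [i|]; first exact: measurableT.
by apply/seteqP; split.
Qed.

Lemma cylinder_setI : setI_closed cylinder.
Proof.
move=> _ _ [n [B [mB ->]]] [m [C [mC ->]]].
exists (maxn n m), (fun i => (if (i < n)%N then B i else setT) `&`
                            (if (i < m)%N then C i else setT)); split.
  by move=> i; apply: measurableI; case: ifP.
apply/seteqP; split => [x [Bx Cx] i _|x BCx].
  by split; case: ifPn => // im; [exact: Bx|exact: Cx].
by split=> i im; have := BCx i; rewrite leq_max im ?orbT => /(_ isT)[].
Qed.

Lemma measurable_proj (i : nat) :
  measurable_fun setT (fun x : realseq R => (x i : R)).
Proof.
apply: (measurability _ (RGenOpens.measurableE R)).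
move=> _ /= [_ [a [b ->]] <-]; rewrite setTI.
apply: sub_sigma_algebra => /=.
apply: open_comp; last exact: interval_open.
by move=> x _; exact: proj_continuous.
Qed.

Lemma cylinder_measurable : cylinder `<=` @measurable _ (realseq R).
Proof.
move=> _ [n [B [mB ->]]].
rewrite (_ : [set _ | _] = \bigcap_(i in [set i | (i < n)%N])
    ((fun x : realseq R => x i) @^-1` B i)); last first.
  by apply/seteqP; split => x Bx.
apply: fin_bigcap_measurable => [|i _]; first exact: finite_II.
by rewrite -[X in measurable X]setTI; exact: measurable_proj.
Qed.

(** Otherwise there are points outside [A] within [1/(n+1)] of [x] in the first [n] coordinates, and
    these converge pointwise to [x]. *)
Lemma nbhs_ptws_box (A : set {ptws nat -> R}) (x : {ptws nat -> R}) :
  nbhs x A -> exists n, [set y | forall i, (i < n)%N ->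
      (`|x i - y i| < n.+1%:R^-1)%R] `<=` A.
Proof.
move=> Ax; apply: contrapT => /forallNP H.
have {H}/choice[y Hy] : forall n, exists y : nat -> R,
    (forall i, (i < n)%N -> `|x i - y i| < n.+1%:R^-1)%R /\ ~ A y.
  by move=> n; have /existsNP[y /not_implyP[yn yA]] := H n; exists y.
have : {ptws, (y @ \oo) --> x}.
  apply/pointwise_cvgP => i.
  suff : y n i @[n --> \oo] --> x i by [].
  apply/cvgrPdist_lt => e e0.
  near=> n; have [/(_ i) + _] := Hy n.
  have ni : (i < n)%N by near: n; exact: nbhs_infty_gt.
  move=> /(_ ni)/lt_trans; apply.
  by near: n; exact: (near_infty_natSinv_lt (PosNum e0)).
move=> /(_ _ Ax) [N _ /(_ N (leqnn N))] /=.
by case: (Hy N).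
Unshelve. all: by end_near. Qed.

(** Second countability: [A] is the union of the countably many rational boxes that it contains. *)
Lemma open_ptws_cylinder (A : set {ptws nat -> R}) :
  open A -> <<s cylinder >> A.
Proof.
move=> oA.
(* The radius is half of that in [nbhs_ptws_box]: by the triangle inequality, the box around a
   rational approximation of [x] stays in [A]. *)
pose box (s : seq rat) : set (nat -> R) := [set y | forall i, (i < size s)%N ->
  (ball (ratr (nth 0%R s i) : R) (size s).+1.*2%:R^-1 (y i))].
have cylb s : cylinder (box s).
  exists (size s), (fun i => ball (ratr (nth 0%R s i) : R) (size s).+1.*2%:R^-1).
  by split => // i; exact: measurable_ball.
rewrite (_ : A = \bigcup_(s : seq rat) (if pselect (box s `<=` A) then box s else set0)).
  apply: (@countable_bigcupT_measurable _ (g_sigma_algebraType cylinder)) => //.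
  move=> s; case: pselect => /= _; last exact: measurable0.
  exact: sub_sigma_algebra.
apply/seteqP; split => [x Ax|x [s _]]; last by case: pselect => //= sA /sA.
have [n nA] := nbhs_ptws_box (open_nbhs_nbhs (conj oA Ax)).
have n0 : (0 < (n.+1.*2%:R)^-1 :> R)%R by rewrite invr_gt0 ltr0n double_gt0.
have /choice[q qx] : forall i, exists q : rat, ball (ratr q : R) n.+1.*2%:R^-1 (x i).
  move=> i.
  have /rat_in_itvoo[q] : (x i - n.+1.*2%:R^-1 < x i + n.+1.*2%:R^-1)%R by lra.
  rewrite in_itv /= => /andP[q1 q2]; exists q.
  by rewrite /ball /= ltr_norml; lra.
exists (mkseq q n) => //; case: pselect => /= [_|nsub].
  by move=> i; rewrite size_mkseq => ni; rewrite nth_mkseq.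
exfalso; apply: nsub => y yb; apply: nA => i ni.
have := yb i; rewrite size_mkseq nth_mkseq// => /(_ ni).
have := qx i; rewrite /ball/= => h1 h2.
rewrite (_ : x i - y i = (ratr (q i) - y i) - (ratr (q i) - x i))%R; last by ring.
rewrite (le_lt_trans (ler_normB _ _))// (lt_le_trans (ltrD h2 h1))//.
by rewrite -muln2 natrM invfM -splitr.
Qed.

Lemma measurable_realseqE : @measurable _ (realseq R) = <<s cylinder >>.
Proof.
apply/seteqP; split; last first.
  apply: smallest_sub; last exact: cylinder_measurable.
  exact: sigma_algebra_measurable.
by apply: smallest_sub; [exact: smallest_sigma_algebra|exact: open_ptws_cylinder].
Qed.

Lemma measurable_fun_realseq d (T : measurableType d) (f : T -> nat -> R) :
  (forall j, measurable_fun setT (f ^~ j)) ->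
  measurable_fun setT (f : T -> realseq R).
Proof.
move=> mf; apply: (measurability _ measurable_realseqE).
move=> _ /= [_ [n [B [mB ->]]] <-]; rewrite setTI.
rewrite (_ : _ @^-1` _ = \bigcap_(i in [set i | (i < n)%N]) ((f ^~ i) @^-1` B i)).
  apply: fin_bigcap_measurable => [|i _]; first exact: finite_II.
  by rewrite -[X in measurable X]setTI; exact: mf.
by apply/seteqP; split => x Bx.
Qed.

(** Both measures agree on the generating pi-system of cylinders. *)
Lemma power_measure_unique (θ : PR R) (m1 m2 : probability (realseq R) R) :
  is_power_measure θ m1 -> is_power_measure θ m2 ->
  forall B : set (realseq R), measurable B -> m1 B = m2 B.
Proof.
move=> h1 h2 B mB.
apply: (@measure_unique _ _ (realseq R) cylinder (fun=> setT) _ _ _ _ m1 m2) => //.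
- exact: measurable_realseqE.
- exact: cylinder_setI.
- by move=> _; exact: cylinderT.
- by rewrite bigcup_const.
- move=> _ [n [C [mC ->]]].
  by transitivity (\prod_(i < n) θ (C i)); [exact: h1|exact/esym/h2].
- by move=> _ /=; rewrite probability_setT ltry.
Qed.

(** The witness [m] ensures that [get] returns a genuine power measure; uniqueness does the rest. *)
Lemma power_measureE (θ : PR R) (m : probability (realseq R) R) :
  is_power_measure θ m ->
  forall B : set (realseq R), measurable B -> power_measure θ B = m B.
Proof.
move=> hm; apply: (@power_measure_unique θ) => //.
rewrite /power_measure; apply: (@getPex _ [set nu | is_power_measure θ nu]).
by exists m.
Qed.

End cylinders.

(** * Reading iid digits off a uniform point *)

Local Notation pushforward_measure :=
  measure_function_pushforward__canonical__measure_function_Measure.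

Section uniform.
Context (R : realType).
Notation mu := (@lebesgue_measure R).

Local Notation unif := (uniform_prob (@ltr01 R)).

Lemma unifE (A : set R) : measurable A -> unif A = mu (A `&` `[0%R, 1%R[).
Proof.
move=> mA; rewrite /uniform_prob integral_uniform_pdf.
rewrite (eq_integral (fun=> 1%:E)); last first.
  move=> x; rewrite inE /= => -[_]; rewrite in_itv /= => x01.
  by rewrite /uniform_pdf x01 subr0 invr1.
rewrite integral_mkcondl -integral_itv_bndo_bndc.
  by rewrite -integral_mkcondl integral_cst ?mul1e//; exact: measurableI.
apply/(measurable_restrict (fun=> 1%:E)) => //.
Qed.

(** The pushforward under the affine map, scaled by [1/p], has the Lebesgue value on half-open
    intervals, hence is Lebesgue measure. *)
Lemma lebesgue_measure_affine (p c : R) (A : set R) : (0 < p)%R -> measurable A ->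
  mu ((fun u => (u - c) / p)%R @^-1` A) = p%:E * mu A.
Proof.
move=> p0 mA.
pose f : R -> measurableTypeR R := fun u => ((u - c) / p)%R.
have mf : measurable_fun setT f.
  by apply: measurable_funM => //; exact: measurable_funB.
have pge : (0 <= p^-1)%R by rewrite invr_ge0 ltW.
pose m := mscale (NngNum pge) (pushforward_measure mu mf).
have : mu A = m A.
  apply: lebesgue_measure_unique => // _ [[a b]] _ <-.
  rewrite /m/= /mscale /pushforward /=.
  rewrite [X in _ * mu X](_ : _ = `](a * p + c)%R, (b * p + c)%R]%classic); last first.
    apply/seteqP; split => x /=; rewrite !in_itv/=.
      by rewrite ltr_pdivlMr// ler_pdivrMr// ltrBrDr lerBlDr.
    by rewrite ltr_pdivlMr// ler_pdivrMr// ltrBrDr lerBlDr.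
  rewrite !lebesgue_measure_itv/= !lte_fin ltrD2r ltr_pM2r//.
  case: ifPn => ab; last by rewrite mule0.
  by rewrite -!EFinB -EFinM; congr EFin; field; rewrite gt_eqF.
rewrite /m /mscale /pushforward /= => ->.
by rewrite muleA -EFinM mulfV ?gt_eqF// mul1e.
Qed.


Lemma unif_affine (p c : R) (A : set R) : (0 < p)%R -> measurable A ->
  unif A = p^-1%:E * mu ((fun u => (u - c) / p)%R @^-1` (A `&` `[0%R, 1%R[)).
Proof.
move=> p0 mA; rewrite lebesgue_measure_affine//; last exact: measurableI.
by rewrite muleA -EFinM mulVf ?gt_eqF// mul1e unifE.
Qed.

End uniform.

(* A point of [0, 1[ is read in the mixed base given by the cut points
   [0 = c 0 <= c 1 <= ... <= c N = 1]: [digit c] is the index of the piece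
   [`[c k, c k.+1[] containing it, and [rescale c] maps that piece affinely
   onto [0, 1[.  For a uniform point the digits read along the orbit of
   [rescale c] are iid with weights [c k.+1 - c k]. *)
Section digits.
Context (R : realType) (N : nat).
Notation mu := (@lebesgue_measure R).
Local Notation unif := (uniform_prob (@ltr01 R)).
Implicit Types (c : nat -> R) (u : R).

Definition digit c u : R :=
  (\sum_(k < N) if (c k <= u) && (u < c k.+1) then k%:R else 0)%R.

Definition rescale c u : R :=
  (\sum_(k < N) if (c k <= u) && (u < c k.+1)
                then (u - c k) / (c k.+1 - c k) else 0)%R.

Definition is_cuts c :=
  [/\ c 0%N = 0%R, c N = 1%R & {homo c : i j / (i <= j)%N >-> (i <= j)%R}].

Lemma piece_uniq c u (f : nat -> R) k : is_cuts c -> (k < N)%N ->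
  (c k <= u < c k.+1)%R ->
  (\sum_(i < N) if (c i <= u) && (u < c i.+1) then f i else 0)%R = f k.
Proof.
move=> [c0 cN ch] kN /andP[ku uk].
rewrite (bigD1 (Ordinal kN))//= ku uk /= big1 ?addr0// => i.
rewrite -val_eqE/= neq_ltn => /orP[] ik; case: ifPn => // /andP[iu ui].
  by have := lt_le_trans ui (le_trans (ch _ _ ik) ku); rewrite ltxx.
by have := lt_le_trans uk (le_trans (ch _ _ ik) iu); rewrite ltxx.
Qed.

Lemma digitE c u k : is_cuts c -> (k < N)%N -> (c k <= u < c k.+1)%R ->
  digit c u = k%:R.
Proof. exact: (@piece_uniq _ _ (fun i => i%:R)). Qed.

Lemma rescaleE c u k : is_cuts c -> (k < N)%N -> (c k <= u < c k.+1)%R ->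
  rescale c u = ((u - c k) / (c k.+1 - c k))%R.
Proof. exact: (@piece_uniq _ _ (fun i => (u - c i) / (c i.+1 - c i))%R). Qed.

Lemma piece_exists c u : is_cuts c -> (0 <= u < 1)%R ->
  exists2 k, (k < N)%N & (c k <= u < c k.+1)%R.
Proof.
move=> [c0 cN ch] /andP[u0 u1].
have ex : exists k, (u < c k)%R by exists N; rewrite cN.
case: (ex_minnP ex) => [[|k] uk kmin]; first by move: uk; rewrite c0 ltNge u0.
exists k; first by apply: kmin; rewrite cN.
by rewrite uk andbT leNgt; apply/negP => /kmin; rewrite ltnn.
Qed.

(** Total probability over the first digit: it equals [k] with probability [c k.+1 - c k], and given
    this the rescaled point is again uniform. *)
Lemma unif_digit_rescale c (E : R -> set R) : is_cuts c ->
  measurable [set u | E (digit c u) (rescale c u)] ->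
  (forall k, measurable (E k%:R)) ->
  unif [set u | E (digit c u) (rescale c u)] =
    \sum_(k < N) (c k.+1 - c k)%:E * unif (E k%:R).
Proof.
move=> hc mA mE.
have [c0 cN ch] := hc.
pose F k : set R := [set u | E (digit c u) (rescale c u)] `&` `[c k, c k.+1[.
have mF k : measurable (F k) by exact: measurableI.
rewrite unifE// (_ : _ `&` _ = \big[setU/set0]_(k < N) F k); last first.
  rewrite -bigcup_mkord; apply/seteqP; split => [u [Eu]|u [k kN [Eu]]].
    rewrite /= in_itv/= => u01; have [k kN ku] := piece_exists hc u01.
    by exists k => //; split => //=; rewrite in_itv.
  rewrite /= !in_itv/= => /andP[ku uk]; split => //.
  by rewrite -c0 -cN (le_trans (ch _ _ (leq0n k)) ku) (lt_le_trans uk)// ch.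
have tF : trivIset `I_N F.
  apply/trivIsetP => i j; wlog ij : i j / (i < j)%N.
    move=> wl iN jN; rewrite neq_ltn => /orP[] ij.
      by apply: wl => //; rewrite neq_ltn ij.
    by rewrite setIC; apply: wl => //; rewrite neq_ltn ij.
  move=> _ _ _; apply/seteqP; split => // u [[_ +] [_]].
  rewrite /= !in_itv/= => /andP[_ ui] /andP[ju _].
  by have := lt_le_trans ui (le_trans (ch _ _ ij) ju); rewrite ltxx.
rewrite measure_semi_additive_ord_I//; last 2 first.
- by move=> *; exact: mF.
- by apply: bigsetU_measurable => *; exact: mF.
apply: eq_bigr => -[k kN] _ /=.
(* An empty piece contributes zero to both sides; the affine change of variables needs positive
   width. *)
have [kk|kk] := ltP (c k) (c k.+1); last first.
  rewrite (_ : F k = set0) ?measure0; last first.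
    apply/seteqP; split => // u [_]; rewrite /= in_itv/= => /andP[ku uk].
    by have := lt_le_trans uk (le_trans kk ku); rewrite ltxx.
  by rewrite (_ : c k = c k.+1) ?subrr ?mul0e//; apply/eqP; rewrite eq_le ch.
have d0 : (0 < c k.+1 - c k)%R by rewrite subr_gt0.
rewrite (unif_affine (c k) d0)// muleA -EFinM mulfV ?gt_eqF// mul1e.
congr (mu _); apply/seteqP; split => u.
  move=> [/= Eu]; rewrite !in_itv/= => kuk; have [ku uk] := andP kuk.
  move: Eu; rewrite (digitE hc kN)// (rescaleE hc kN)// => Eu.
  split => //=; rewrite divr_ge0 ?subr_ge0// 1?ltW//=.
  by rewrite ltr_pdivrMr// mul1r ltrD2r.
move=> [/= Eu]; rewrite !in_itv/=.
rewrite ler_pdivlMr// mul0r subr_ge0 ltr_pdivrMr// mul1r ltrD2r => kuk.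
split => /=; last by rewrite in_itv.
by rewrite (digitE hc kN)// (rescaleE hc kN).
Qed.

End digits.

Lemma measurable_invr (R : realType) : measurable_fun setT (@GRing.inv R).
Proof.
rewrite (_ : @GRing.inv R = fun x => if x == 0%R then 0%R else (x^-1)%R).
  apply: measurable_fun_if => //.
    exact: measurable_fun_eqr.
  have -> : setT `&` (fun x : R => x == 0%R) @^-1` [set false] = [set x | (x != 0)%R].
    by rewrite setTI; apply/seteqP; split => x /=; [move=> /negbT|move=> /negbTE].
  apply: open_continuous_measurable_fun => //.
  by apply/in_setP => x /= x0; exact: inv_continuous.
by apply/funext => x; case: eqP => // ->; rewrite invr0.
Qed.

Section digit_sequence.
Context (R : realType) (N : nat).
Local Notation unif := (uniform_prob (@ltr01 R)).
Local Notation digit := (@digit R N).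
Local Notation rescale := (@rescale R N).
Local Notation is_cuts := (@is_cuts R N).

Section measurability.
Context d (T : measurableType d) (c : T -> nat -> R) (g : T -> R).
Hypothesis mc : forall k, measurable_fun setT (c ^~ k).
Hypothesis mg : measurable_fun setT g.

Let measurable_in_piece k :
  measurable_fun setT (fun t => (c t k <= g t) && (g t < c t k.+1))%R.
Proof.
by apply: measurable_and; [exact: measurable_fun_ler|exact: measurable_fun_ltr].
Qed.

Lemma measurable_digit : measurable_fun setT (fun t => digit (c t) (g t)).
Proof.
apply: measurable_sum => k; exact: measurable_fun_ifT.
Qed.

Lemma measurable_rescale : measurable_fun setT (fun t => rescale (c t) (g t)).
Proof.
apply: measurable_sum => k; apply: measurable_fun_ifT => //.
apply: measurable_funM; first exact: measurable_funB.
apply: measurableT_comp; last exact: measurable_funB.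
exact: measurable_invr.
Qed.

End measurability.

Definition digits (c : nat -> R) (j : nat) (u : R) : R :=
  digit c (iter j (rescale c) u).

Lemma digitsS c j u : digits c j.+1 u = digits c j (rescale c u).
Proof. by rewrite /digits iterSr. Qed.

Lemma measurable_digits d (T : measurableType d) (c : T -> nat -> R)
    (g : T -> R) j :
  (forall k, measurable_fun setT (c ^~ k)) -> measurable_fun setT g ->
  measurable_fun setT (fun t => digits (c t) j (g t)).
Proof.
move=> mc mg; apply: measurable_digit => //.
by elim: j => //= j; exact: measurable_rescale.
Qed.

Let measurable_digits1 c j : measurable_fun setT (digits c j).
Proof. exact: (@measurable_digits _ _ (fun=> c) id). Qed.

Lemma measurable_digits_box c n (B : nat -> set R) :
  (forall i, measurable (B i)) ->
  measurable [set u | forall i, (i < n)%N -> B i (digits c i u)].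
Proof.
move=> mB; rewrite (_ : [set _ | _] =
    \bigcap_(i in [set i | (i < n)%N]) (digits c i @^-1` B i)).
  apply: fin_bigcap_measurable => [|i _]; first exact: finite_II.
  by rewrite -[X in measurable X]setTI; exact: measurable_digits1.
by apply/seteqP; split.
Qed.

(** Induction on [n]: the digits after the first are the digits of the rescaled point, which is
    uniform and independent of the first digit. *)
Lemma unif_digits_box (θ : set R -> \bar R) c n (B : nat -> set R) :
  is_cuts c ->
  (forall A, measurable A ->
    θ A = \sum_(k < N) (c k.+1 - c k)%:E * (\1_A (k%:R : R))%:E) ->
  (forall i, measurable (B i)) ->
  unif [set u | forall i, (i < n)%N -> B i (digits c i u)] =
    \prod_(i < n) θ (B i).
Proof.
move=> hc hθ; elim: n B => [|n IH] B mB.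
  rewrite big_ord0 (_ : [set _ | _] = setT) ?probability_setT//.
  by apply/seteqP; split.
pose S : set R := [set v | forall i, (i < n)%N -> B i.+1 (digits c i v)].
have mS : measurable S.
  by apply: (@measurable_digits_box c n (fun i => B i.+1)) => i; exact: mB.
(* The event is put in the form digit and remainder: the first digit decides between [S] and the
   empty set. *)
pose E (x : R) : set R := if pselect (B 0%N x) then S else set0.
have mE x : measurable (E x).
  by rewrite /E; case: pselect => ? /=; [exact: mS|exact: measurable0].
have EE : [set u | forall i, (i < n.+1)%N -> B i (digits c i u)] =
    [set u | E (digit c u) (rescale c u)].
  apply/seteqP; split => u /=; rewrite /E.
    move=> uB; case: pselect => /= [_ i ni|nB]; last by apply: nB; exact: (uB 0%N).
    by have := uB i.+1; rewrite digitsS; apply.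
  by case: pselect => //= B0 Su [//|i]; rewrite ltnS digitsS => /Su.
rewrite EE unif_digit_rescale//; last by rewrite -EE; exact: measurable_digits_box.
rewrite big_ord_recl -(IH (fun i => B i.+1))// -/S hθ//.
rewrite ge0_sume_distrl => [|k _]; last first.
  rewrite mule_ge0 ?lee_fin ?subr_ge0 //.
  by case: hc => _ _ ch; exact: ch.
apply: eq_bigr => k _; rewrite -muleA; congr (_ * _).
rewrite /E indicE; case: pselect => /= Bk; first by rewrite mem_set// mul1e.
by rewrite memNset// measure0 mul0e.
Qed.

Lemma sum_digitsS c n u : (\sum_(j < n.+1) digits c j u =
  digit c u + \sum_(j < n) digits c j (rescale c u))%R.
Proof.
by rewrite big_ord_recl; congr (_ + _)%R; apply: eq_bigr => j _; rewrite digitsS.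
Qed.

(** The generating function of a sum of iid digits is a power. The offset [s] stands for digits
    already read, so that the induction goes through, and the bound on [M] ensures that every
    possible value of the sum is counted. *)
Lemma genfun_sum_digits c n s M (z : R) : is_cuts c -> (0 <= z)%R ->
  (s + n * N.-1 < M)%N ->
  \sum_(m < M) (z ^+ m)%:E *
    unif [set u | s%:R + \sum_(j < n) digits c j u = m%:R]%R =
  (z ^+ s * (\sum_(k < N) (c k.+1 - c k) * z ^+ k) ^+ n)%:E.
Proof.
move=> hc z0; elim: n s => [|n IH] s sM.
  rewrite addn0 in sM; rewrite expr0 mulr1 (bigD1 (Ordinal sM))//= big1 ?adde0.
    rewrite (_ : [set _ | _] = setT) ?probability_setT ?mule1//.
    by apply/seteqP; split => // u _ /=; rewrite big_ord0 addr0.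
  move=> m; rewrite -val_eqE /= => ms.
  rewrite (_ : [set _ | _] = set0) ?measure0 ?mule0//.
  apply/seteqP; split => // u /=; rewrite big_ord0 addr0 => /eqP.
  by rewrite eqr_nat eq_sym (negbTE ms).
pose E m (x : R) : set R := [set v | s%:R + x + \sum_(j < n) digits c j v = m%:R]%R.
have EE m : [set u | s%:R + \sum_(j < n.+1) digits c j u = m%:R]%R =
    [set u | E m (digit c u) (rescale c u)].
  by apply/seteqP; split => u /=; rewrite /E /= sum_digitsS addrA.
have msum a b m : measurable [set v | a + \sum_(j < b) digits c j v = m%:R]%R.
  rewrite [X in measurable X](_ : _ =
    (fun v => a + \sum_(j < b) digits c j v)%R @^-1` [set m%:R]) //.
  rewrite -[X in measurable X]setTI.
  have : measurable_fun setT (fun v => a + \sum_(j < b) digits c j v)%R.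
    by apply: measurable_funD => //; exact: measurable_sum.
  by apply.
have mEE m : measurable [set u | E m (digit c u) (rescale c u)].
  by rewrite -EE.
under eq_bigr => m _.
  rewrite EE unif_digit_rescale//; last by move=> k; exact: msum.
  rewrite ge0_sume_distrr; last first.
    move=> k _; rewrite mule_ge0 ?lee_fin ?subr_ge0//.
    by case: hc => _ _ ch; exact: ch.
  under eq_bigr do rewrite muleCA.
  over.
rewrite exchange_big/=.
under eq_bigr => k _.
  rewrite -ge0_sume_distrr => [|m _]; last first.
    by rewrite mule_ge0// lee_fin exprn_ge0.
  under eq_bigr do rewrite /E -natrD.
  (* The offset becomes [s + k] with [k <= N.-1], so the bound on [M] passes from [n.+1] digits to
     [n]. *)
  rewrite IH -?EFinM; last first.
    apply: leq_trans sM; rewrite ltnS mulSn addnA leq_add2r leq_add2l.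
    by move: (ltn_ord k); case: N k.
  over.
rewrite sumEFin; congr EFin; rewrite exprS mulrA mulr_sumr mulr_suml.
by apply: eq_bigr => k _; rewrite exprD; ring.
Qed.

End digit_sequence.

(** * Realization of iid mixtures *)

Import HBNNSimple.

(* [f] need not be measurable: in [iid_mixture] it is [θ |-> power_measure θ B],
   which is only known to be well behaved almost everywhere. *)
Lemma ge0_integral_eq_full d (T : measurableType d) (R : realType)
    (mu : {measure set T -> \bar R}) (D : set T) (f g : T -> \bar R) :
  measurable D -> mu (~` D) = 0 -> measurable_fun setT g ->
  (forall x, 0 <= f x) -> (forall x, 0 <= g x) -> (forall x, D x -> f x = g x) ->
  \int[mu]_x f x = \int[mu]_x g x.
Proof.
move=> mD D0 mg f0 g0 fg.
have mgD : measurable_fun setT (g \_ D).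
  by apply/(measurable_restrictT _ _).1 => //; exact: measurable_funTS.
have restr (h : T -> \bar R) : measurable_fun setT h -> (forall x, 0 <= h x) ->
    \int[mu]_x h x = \int[mu]_x (h \_ D) x.
  move=> mh h0; rewrite (ge0_negligible_integral _ _ mh _ D0)//.
    by rewrite setTD setCK integral_mkcond.
  exact: measurableC.
apply/eqP; rewrite eq_le; apply/andP; split.
  (* A simple function below [f], cut to zero off [D], has the same integral and lies below [g]. *)
  rewrite ge0_integralTE//; apply: ge_ereal_sup => _ [h /= hf <-].
  rewrite -integralT_nnsfun restr//; last 2 first.
    exact/measurable_EFinP.
    by move=> x; rewrite lee_fin.
  apply: ge0_le_integral => //.
  - by move=> x _; apply: erestrict_ge0 => // y _; rewrite lee_fin.
  - by apply/(measurable_restrictT _ _).1 => //; exact/measurable_EFinP/measurable_funTS.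
  - move=> x _; rewrite patchE; case: ifPn => // xD.
    by rewrite -fg//; exact: set_mem.
(* Conversely, a simple function below the restriction of [g] to [D] lies below [f]. *)
rewrite restr// ge0_integralTE//; last by move=> x; exact: erestrict_ge0.
rewrite ge0_integralTE//; apply: ereal_sup_le => _ [h /= hg <-].
exists h => // x; apply: (le_trans (hg x)).
by rewrite patchE; case: ifPn => // xD; rewrite fg//; exact: set_mem.
Qed.

Lemma measurable_prob_eval d (T : measurableType d) (R : realType) (A : set T) :
  measurable A ->
  measurable_fun setT (fun θ : pprobability T R => θ A).
Proof.
move=> mA; exact: (measurable_kernel (kprobability (@measurable_id _ _ setT)) A mA).
Qed.

(** * Cumulative weights of a law as cut points *)

Section cumulative.
Context (R : realType).

(** With the half-line open, a law on the naturals has [cum θ 0 = 0], and the weight of [k] is the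
    increment from [k] to [k.+1]. *)
Definition cum (θ : PR R) (k : nat) : R := fine (θ `]-oo, k%:R[%classic).

Lemma measurable_cum k : measurable_fun setT (cum ^~ k).
Proof.
apply: measurableT_comp => //; exact: measurable_prob_eval.
Qed.

Lemma cum_homo (θ : PR R) : {homo cum θ : i j / (i <= j)%N >-> (i <= j)%R}.
Proof.
move=> i j ij; rewrite /cum fine_le ?probability_fin//.
  exact: fin_num_measure.
  exact: fin_num_measure.
apply: le_measure; rewrite ?inE//.
move=> x /=; rewrite !in_itv/= => /lt_le_trans; apply.
by rewrite ler_nat.
Qed.

Definition naturals (N : nat) : set R := \big[setU/set0]_(k < N) [set k%:R].

Lemma measurable_naturals N : measurable (naturals N).
Proof. exact: bigsetU_measurable. Qed.

Lemma measure_naturals (θ : PR R) N :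
  θ (naturals N) = \sum_(k < N) θ [set k%:R].
Proof.
rewrite /naturals measure_semi_additive_ord//.
- apply/trivIsetP => i j _ _ ij; apply/seteqP; split => // x [/= -> /eqP].
  by rewrite eqr_nat => /eqP /val_inj ij'; rewrite ij' eqxx in ij.
- exact: bigsetU_measurable.
Qed.

Lemma prob_naturalsE (θ : PR R) N (A : set R) :
  θ (naturals N) = 1 -> measurable A ->
  θ A = \sum_(k < N) (fine (θ [set k%:R]))%:E * (\1_A (k%:R : R))%:E.
Proof.
move=> θN mA.
have mN := measurable_naturals N.
have -> : θ A = θ (A `&` naturals N).
  rewrite -[in LHS](setUIDK A (naturals N)) measureU//; last 3 first.
    exact: measurableI.
    exact: measurableD.
    by rewrite setDE setIACA setICr !setI0.
  rewrite [X in _ + X](_ : _ = 0) ?adde0//.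
  apply/eqP; rewrite -measure_le0.
  have <- : θ (~` naturals N) = 0 by rewrite probability_setC// θN subee.
  apply: le_measure; rewrite ?inE//; first exact: measurableD.
  exact: measurableC.
have -> : A `&` naturals N = \big[setU/set0]_(k < N) (A `&` [set k%:R]).
  by rewrite /naturals big_distrr.
rewrite measure_semi_additive_ord.
- apply: eq_bigr => k _; rewrite fineK ?fin_num_measure// indicE.
  have [kA|kA] := boolP (k%:R \in A).
    by rewrite mule1 setIidr// => _ ->; exact: set_mem.
  rewrite mule0 (_ : _ `&` _ = set0) ?measure0//.
  by apply/seteqP; split => // x [+ xk]; rewrite xk -in_setE (negbTE kA).
- by move=> k; exact: measurableI.
- apply/trivIsetP => i j _ _ ij; apply/seteqP; split => // x [[_ /= ->] [_ /= /eqP]].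
  by rewrite eqr_nat => /eqP /val_inj ij'; rewrite ij' eqxx in ij.
- by apply: bigsetU_measurable => k _; exact: measurableI.
Qed.

Lemma cum_diff (θ : PR R) N (k : 'I_N) : θ (naturals N) = 1 ->
  (cum θ k.+1 - cum θ k)%R = fine (θ [set k%:R]).
Proof.
move=> θN; apply/eqP; rewrite subr_eq; apply/eqP; rewrite /cum -fineD ?fin_num_measure//.
congr fine; rewrite -measureU//; last first.
  by apply/seteqP; split => // x [/= ->]; rewrite in_itv/= ltxx.
rewrite (prob_naturalsE θN)// [RHS](prob_naturalsE θN)//; last first.
  exact: measurableU.
apply: eq_bigr => i _; congr (_ * (_)%:E); rewrite !indicE; congr (nat_of_bool _)%:R.
apply/idP/idP; rewrite !inE/= in_itv/= ltr_nat ?ltnS.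
  rewrite leq_eqVlt => /orP[/eqP ->|ik]; first by left.
  by right; rewrite /= in_itv/= ltr_nat.
move=> [/eqP|]; first by rewrite eqr_nat => /eqP ->; rewrite in_itv/= ltr_nat.
by rewrite /= !in_itv/= !ltr_nat ltnS => /ltnW.
Qed.

Lemma is_cuts_cum (θ : PR R) N : θ (naturals N) = 1 -> is_cuts N (cum θ).
Proof.
move=> θN; split; last exact: cum_homo.
- rewrite /cum (prob_naturalsE θN)// big1// => k _.
  by rewrite indicE memNset ?mule0//= in_itv/= ltNge ler0n.
- rewrite /cum (_ : θ _ = 1)// (prob_naturalsE θN)//.
  rewrite -[RHS]θN [RHS](prob_naturalsE θN)//; last exact: measurable_naturals.
  apply: eq_bigr => k _.
  have kN : naturals N k%:R.
    by rewrite /naturals -(bigcup_mkord N (fun i => [set i%:R])); exists k => /=.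
  have kN' : `]-oo, N%:R[%classic (k%:R : R) by rewrite /= in_itv/= ltr_nat.
  by rewrite !indicE !mem_set.
Qed.

Lemma prob_cumE (θ : PR R) N (A : set R) :
  θ (naturals N) = 1 -> measurable A ->
  θ A = \sum_(k < N) (cum θ k.+1 - cum θ k)%:E * (\1_A (k%:R : R))%:E.
Proof.
move=> θN mA; rewrite (prob_naturalsE θN)//; apply: eq_bigr => k _.
by rewrite (cum_diff _ θN).
Qed.

End cumulative.

(** * The digit sequence of a random law *)

Section iid_realization.
Context (R : realType) (N : nat).
Local Notation unif := (uniform_prob (@ltr01 R)).
Local Notation U := (measurableTypeR R).
Local Notation digits := (@digits R N).

Let measurable_cum_digits j :
  measurable_fun setT (fun w : PR R * U => digits (cum w.1) j w.2).
Proof.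
apply: measurable_digits => // k.
exact: (measurableT_comp (@measurable_cum R k) measurable_fst).
Qed.

Definition digit_rv (j : nat) : {mfun (PR R * U)%type >-> R} :=
  HB.pack (fun w : PR R * U => digits (cum w.1) j w.2)
    (isMeasurableFun.Build _ _ _ _ _ (measurable_cum_digits j)).

Let measurable_digits_seq c :
  measurable_fun setT (fun u : U => (digits c ^~ u) : realseq R).
Proof.
by apply: measurable_fun_realseq => j; exact: (@measurable_digits R N _ U (fun=> c) id).
Qed.

Let measurable_sum_digits n :
  measurable_fun setT (fun w => \sum_(j < n) digit_rv j w)%R.
Proof. by apply: measurable_sum => j; exact: measurable_funP. Qed.

(** Bundled as a measurable function, so that its [distribution] is a probability on the reals. *)
Definition sum_digit_rv (n : nat) : {mfun (PR R * U)%type >-> R} :=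
  HB.pack (fun w => \sum_(j < n) digit_rv j w)%R
    (isMeasurableFun.Build _ _ _ _ _ (measurable_sum_digits n)).

Definition digit_seq c : {mfun U >-> realseq R} :=
  HB.pack (fun u : U => (digits c ^~ u) : realseq R)
    (isMeasurableFun.Build _ _ _ _ _ (measurable_digits_seq c)).

(** By [unif_digits_box], the law of the digit sequence is a power measure of [θ]. *)
Lemma power_measure_digits (θ : PR R) (B : set (realseq R)) :
  θ (@naturals R N) = 1 -> measurable B ->
  power_measure θ B = unif [set u | B (digits (cum θ) ^~ u)].
Proof.
move=> θN mB.
rewrite (@power_measureE _ θ (distribution unif (digit_seq (cum θ))))//.
move=> n C mC; rewrite -(unif_digits_box _ (is_cuts_cum θN))//.
by move=> A mA; exact: prob_cumE.
Qed.

Context (Θ : PPR R).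
Hypothesis ΘN : Θ (supported_in (@naturals R N)) = 1.

Local Notation P := (Θ \x unif : probability _ _).

Let mD : measurable (supported_in (@naturals R N)).
Proof. by apply: measurable_supported_in; exact: measurable_naturals. Qed.

Let ΘCN : Θ (~` supported_in (@naturals R N)) = 0.
Proof. by rewrite probability_setC// ΘN subee. Qed.

Let product_unifE (A : set (PR R * U)) :
  P A = \int[Θ]_θ unif [set u | A (θ, u)].
Proof.
rewrite /= /product_measure1; apply: eq_integral => θ _ /=.
by congr (unif _); apply/seteqP; split => u /=; rewrite /xsection/= inE.
Qed.

Let measurable_section (A : set (PR R * U)) : measurable A ->
  measurable_fun setT (fun θ => unif [set u | A (θ, u)]).
Proof.
move=> mA; rewrite (_ : (fun _ => _) = unif \o xsection A).
  exact: measurable_fun_xsection.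
apply/funext => θ /=.
by congr (unif _); apply/seteqP; split => u /=; rewrite /xsection/= inE.
Qed.

(** Slicing at fixed [θ] gives the power measure whenever [θ] lives on the first [N] naturals, that
    is, for almost every [θ]. *)
Lemma iid_mixture_digits : iid_mixture Θ (digit_rv : nat -> {RV P >-> R}).
Proof.
move=> B mB; rewrite product_unifE /=; apply/esym.
apply: (ge0_integral_eq_full mD) => //.
- apply: (measurable_section (A := [set w | B (fun j => digit_rv j w)])).
  have : measurable_fun setT (fun w => (digit_rv ^~ w) : realseq R).
    by apply: measurable_fun_realseq => j; exact: measurable_funP.
  by move=> /(_ measurableT B mB); rewrite setTI.
- by move=> θ θN; exact: power_measure_digits.
Qed.

Let measurable_sum_digit_rv n (x : R) :
  measurable [set w | \sum_(j < n) digit_rv j w = x]%R.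
Proof.
by have /(_ setT measurableT [set x] (measurable_set1 x)) :=
  measurable_funP (sum_digit_rv n); rewrite setTI.
Qed.

(** Thus the law of the [n]-th partial sum sees Θ only through the [n]-th moments of the generating
    polynomial of [θ] at the points [z]. *)
Lemma genfun_sum_digit_rv n M (z : R) : (0 <= z)%R -> (n * N.-1 < M)%N ->
  \sum_(m < M) (z ^+ m)%:E * distribution P (sum_digit_rv n) [set m%:R] =
  \int[Θ]_θ ((\sum_(k < N) (cum θ k.+1 - cum θ k) * z ^+ k) ^+ n)%:E.
Proof.
move=> z0 nM.
have ms := fun m => measurable_section (measurable_sum_digit_rv n m%:R).
pose F (m : 'I_M) (θ : PR R) := (z ^+ m)%:E *
  unif [set u | \sum_(j < n) digit_rv j (θ, u) = m%:R]%R.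
have mF m : measurable_fun setT (F m) by apply: measurable_funeM; exact: ms.
transitivity (\sum_(m < M) \int[Θ]_θ F m θ).
  apply: eq_bigr => m _; apply/esym/(etrans (y := (z ^+ m)%:E *
      \int[Θ]_θ unif [set u | \sum_(j < n) digit_rv j (θ, u) = m%:R]%R)).
    by rewrite /F ge0_integralZl// ?lee_fin ?exprn_ge0//; exact: ms.
  by congr (_ * _); apply/esym; exact: product_unifE.
rewrite -ge0_integral_sum//; last first.
  by move=> m x _; rewrite /F mule_ge0// lee_fin exprn_ge0.
apply/esym/(ge0_integral_eq_full mD) => //.
- by apply: emeasurable_sum => m; exact: mF.
- move=> θ; rewrite lee_fin exprn_ge0// sumr_ge0// => k _.
  by rewrite mulr_ge0 ?exprn_ge0// subr_ge0 cum_homo.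
- by move=> θ; rewrite sume_ge0// => m _; rewrite /F mule_ge0// lee_fin exprn_ge0.
- move=> θ θN; rewrite /F; have := genfun_sum_digits (is_cuts_cum θN) z0 (s := 0) nM.
  rewrite expr0 mul1r => <-.
  by apply: eq_bigr => m _; under eq_set do rewrite add0r.
Qed.

End iid_realization.

(** * Laws on finitely many naturals *)

Section digit_law.
Context (R : realType) (N : nat).
Local Notation unif := (uniform_prob (@ltr01 R)).
Local Notation U := (measurableTypeR R).
Local Notation digit := (@digit R N).

Let measurable_digit1 c : measurable_fun setT (digit c : U -> R).
Proof. exact: (@measurable_digit R N _ U (fun=> c) id). Qed.

Definition digit_mfun c : {mfun U >-> R} :=
  HB.pack (digit c : U -> R) (isMeasurableFun.Build _ _ _ _ _ (measurable_digit1 c)).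

(** As the law of a single digit, it is a probability measure for every [c]. *)
Definition digit_law c : PR R := distribution unif (digit_mfun c).

Lemma digit_lawE c (A : set R) : is_cuts N c -> measurable A ->
  digit_law c A = \sum_(k < N) (c k.+1 - c k)%:E * (\1_A (k%:R : R))%:E.
Proof.
move=> hc mA.
pose E (x : R) : set R := if pselect (A x) then setT else set0.
have EE : digit c @^-1` A = [set u | E (digit c u) (rescale N c u)].
  by apply/seteqP; split => u /=; rewrite /E; case: pselect.
rewrite /digit_law /distribution /pushforward /= EE unif_digit_rescale//.
- apply: eq_bigr => k _; congr (_ * _); rewrite /E indicE.
  case: pselect => /= kA; first by rewrite mem_set// probability_setT.
  by rewrite memNset// measure0.
- by rewrite -EE -[X in measurable X]setTI; exact: measurable_digit1.
- by move=> k; rewrite /E; case: pselect => _ /=.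
Qed.

Lemma digit_law_naturals c : is_cuts N c -> digit_law c (@naturals R N) = 1.
Proof.
move=> hc; rewrite digit_lawE//; last exact: measurable_naturals.
rewrite (eq_bigr (fun k : 'I_N => (c k.+1 - c k)%:E)) => [|k _]; last first.
  rewrite indicE mem_set ?mule1//.
  by rewrite /naturals -(bigcup_mkord N (fun i => [set i%:R])); exists k => /=.
rewrite sumEFin -(big_mkord xpredT (fun k => c k.+1 - c k)%R) telescope_sumr//.
by case: hc => -> -> _; rewrite subr0.
Qed.

Lemma cum_digit_law c k : is_cuts N c -> (k <= N)%N -> cum (digit_law c) k = c k.
Proof.
move=> hc; have lN := digit_law_naturals hc.
have [cu0 _ _] := is_cuts_cum lN; have [c0 _ _] := hc.
elim: k => [|k IH] kN; first by rewrite cu0 c0.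
apply/eqP; rewrite -(subrK (cum (digit_law c) k) (cum _ _)) {2}IH ?(ltnW kN)//.
rewrite (@cum_diff _ _ N (Ordinal kN))// digit_lawE//.
rewrite (bigD1 (Ordinal kN))//= big1 => [|i]; last first.
  rewrite -val_eqE/= => ik; rewrite indicE memNset ?mule0//= => /eqP.
  by rewrite eqr_nat (negbTE ik).
by rewrite indicE mem_set// mule1 adde0 /= subrK.
Qed.

(** It suffices to test evaluations at measurable sets, and these are measures of sections of a
    measurable set in [T * U]. *)
Lemma measurable_digit_law d (T : measurableType d) (c : T -> nat -> R) :
  (forall k, measurable_fun setT (c ^~ k)) ->
  measurable_fun setT (fun t => digit_law (c t)).
Proof.
move=> mc.
apply: (measurability (@pset _ _ _ : set (set (PR R)))) => //.
move=> _ -[_ [r r01] [A mA <-]] <-; rewrite /mset /preimage/=.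
apply: emeasurable_fun_infty_o => //.
have md : measurable_fun setT (fun w : T * U => digit (c w.1) w.2).
  by apply: measurable_digit => // k; exact: (measurableT_comp (mc k) measurable_fst).
have := md measurableT A mA; rewrite setTI => /(measurable_fun_xsection unif).
congr (measurable_fun _ _); apply/funext => t.
by rewrite /= /xsection; congr (unif _); apply/seteqP; split => u /=; rewrite inE.
Qed.

End digit_law.

Section average.
Context d (T : measurableType d) (R : realType) (m : nat -> probability T R).

Let quarter_ge0 : (0 <= 4^-1 :> R)%R. Proof. by rewrite invr_ge0. Qed.

Definition average4 := mscale (NngNum quarter_ge0) (msum m 4).

HB.instance Definition _ := Measure.on average4.

Lemma average4E A : average4 A = (4^-1)%:E * \sum_(i < 4) m i A.
Proof. by []. Qed.

Let average4_setT : average4 setT = 1.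
Proof.
rewrite average4E; under eq_bigr do rewrite probability_setT.
by rewrite sumEFin -EFinM sumr_const card_ord mulVf.
Qed.

HB.instance Definition _ := Measure_isProbability.Build _ _ _ average4 average4_setT.

Lemma ge0_integral_average4 (f : T -> \bar R) :
  measurable_fun setT f -> (forall x, 0 <= f x) ->
  \int[average4]_x f x = (4^-1)%:E * \sum_(i < 4) \int[m i]_x f x.
Proof.
by move=> mf f0; rewrite ge0_integral_mscale// ge0_integral_measure_sum.
Qed.

End average.

(** Both laws live on the naturals below [M], and the difference of their generating polynomials has
    infinitely many roots. *)
Lemma prob_genfun_inj (R : realType) (m1 m2 : probability R R) (M : nat) :
  \sum_(m < M) m1 [set m%:R] = 1 -> \sum_(m < M) m2 [set m%:R] = 1 ->
  (forall z : R, (1 < z)%R ->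
    \sum_(m < M) (z ^+ m)%:E * m1 [set m%:R] =
    \sum_(m < M) (z ^+ m)%:E * m2 [set m%:R]) ->
  forall B, measurable B -> m1 B = m2 B.
Proof.
rewrite -!measure_naturals => m1M m2M mz B mB.
rewrite (prob_naturalsE m1M)// (prob_naturalsE m2M)//.
apply: eq_bigr => k _; congr (_%:E * _).
pose a m := (fine (m1 [set m%:R]) - fine (m2 [set m%:R]))%R.
pose p := \poly_(m < M) a m.
have pz z : (1 < z)%R -> p.[z] = 0%R.
  move=> z1; have := mz z z1.
  under eq_bigr do rewrite -[m1 _]fineK ?fin_num_measure// -EFinM.
  under [X in _ = X -> _]eq_bigr do rewrite -[m2 _]fineK ?fin_num_measure// -EFinM.
  rewrite !sumEFin => -[] /eqP; rewrite -subr_eq0 -sumrB => /eqP <-.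
  by rewrite horner_poly; apply: eq_bigr => i _; rewrite -mulrBr mulrC.
have p0 : p = 0%R.
  apply/eqP; apply: contraT => pN0.
  (* The [size p] distinct points 2, 3, ... all exceed 1 and are too many roots for a nonzero
     [p]. *)
  have := max_poly_roots (rs := [seq (i.+2%:R : R) | i <- iota 0 (size p)]) pN0.
  rewrite size_map size_iota ltnn => -> //.
    by apply/allP => _ /mapP[i _ ->]; rewrite /root pz ?ltr1n.
  by rewrite map_inj_uniq ?iota_uniq// => i j /eqP; rewrite eqr_nat => /eqP[].
have : p`_k = 0%R by rewrite p0 coef0.
by rewrite coef_poly ltn_ord => /eqP; rewrite subr_eq0 => /eqP.
Qed.

(** * Integrals of powers over the unit square *)

Section polynomial_integrals.
Local Open Scope ring_scope.
Context (R : realType).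
Notation mu := (@lebesgue_measure R).

Lemma integral01_antiderivative (F f : R -> R) :
  (forall x, is_derive x (1 : R) F (f x)) -> continuous f ->
  (\int[mu]_(x in `[0%R, 1%R]) (f x)%:E = (F 1%R - F 0%R)%:E)%E.
Proof.
move=> dF cf.
have cF : continuous F.
  move=> x; apply/differentiable_continuous/derivable1_diffP.
  by case: (dF x).
rewrite (@continuous_FTC2 _ f F)//.
- exact: continuous_subspaceT.
- split => [x _||]; first by case: (dF x).
    exact/cvg_at_right_filter/cF.
  exact/cvg_at_left_filter/cF.
- by move=> x _; rewrite derive1E; case: (dF x).
Qed.

Lemma is_derive_affine_pow (s x u : R) n :
  is_derive u (1 : R) (fun u => (x + s * u) ^+ n.+1)
    (n.+1%:R * s * (x + s * u) ^+ n).
Proof.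
have -> : (fun u => (x + s * u) ^+ n.+1) = (cst x + s *: id) ^+ n.+1.
  by apply/funext => v; rewrite fctE.
have := is_deriveX n.+1 (is_deriveD (is_derive_cst x u 1)
  (is_deriveZ s (is_derive_id u 1))).
by rewrite add0r /GRing.scale /= mulr1 mulrAC.
Qed.

Lemma is_derive_affine_antiderivative (s x u : R) n : s != 0 ->
  is_derive u (1 : R) (fun u => (s * n.+1%:R)^-1 * (x + s * u) ^+ n.+1)
    ((x + s * u) ^+ n).
Proof.
move=> s0; have n0 : n.+1%:R != 0 :> R by rewrite pnatr_eq0.
have := is_deriveZ (s * n.+1%:R)^-1 (is_derive_affine_pow s x u n).
by rewrite /GRing.scale/= mulrA (mulrC s) mulVf ?mul1r// mulf_neq0.
Qed.

Lemma continuous_affine_pow (s x : R) n :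
  continuous (fun u : R => (x + s * u) ^+ n).
Proof.
case: n => [|n]; first exact: cst_continuous.
move=> u; apply/differentiable_continuous/derivable1_diffP.
by case: (is_derive_affine_pow s x u n).
Qed.

Lemma integral_affine_pow1 (x s : R) n : s != 0 ->
  (\int[mu]_(u in `[0%R, 1%R]) ((x + s * u) ^+ n)%:E =
  ((s * n.+1%:R)^-1 * (x + s) ^+ n.+1 - (s * n.+1%:R)^-1 * x ^+ n.+1)%:E)%E.
Proof.
move=> s0; rewrite (integral01_antiderivative
  (fun u => is_derive_affine_antiderivative x u n s0)).
  by rewrite mulr1 mulr0 addr0.
exact: continuous_affine_pow.
Qed.

(** Integrating twice leaves a mixed second difference of the power [n.+2], the form in which the
    two mixtures are compared. *)
Lemma integral_affine_pow2 (x s t : R) n : s != 0 -> t != 0 ->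
  (\int[mu]_(u in `[0%R, 1%R]) \int[mu]_(v in `[0%R, 1%R])
     ((x + s * u + t * v) ^+ n)%:E =
  (((x + s + t) ^+ n.+2 - (x + s) ^+ n.+2 - (x + t) ^+ n.+2 + x ^+ n.+2) /
     (s * t * (n.+1%:R * n.+2%:R)))%:E)%E.
Proof.
move=> s0 t0.
under eq_integral do rewrite integral_affine_pow1// (addrAC x _ t).
(* The inner integral is a difference of two terms with base points [x + t] and [x]; [A y] is the
   antiderivative of the term with base point [y]. *)
pose A y u := (t * n.+1%:R)^-1 * ((s * n.+2%:R)^-1 * (y + s * u) ^+ n.+2).
have dA y u : is_derive u (1 : R) (A y) ((t * n.+1%:R)^-1 * (y + s * u) ^+ n.+1).
  exact/is_deriveZ/is_derive_affine_antiderivative.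
have dD u : is_derive u (1 : R) (A (x + t) - A x)
    ((t * n.+1%:R)^-1 * (x + t + s * u) ^+ n.+1 -
     (t * n.+1%:R)^-1 * (x + s * u) ^+ n.+1).
  by apply: is_deriveB; exact: dA.
rewrite (integral01_antiderivative dD).
  congr EFin; rewrite /A !fctE/= mulr1 mulr0 !addr0 (addrAC x t).
  by field; apply/and4P; split; rewrite // -natrD pnatr_eq0.
have cM y : continuous (fun u => (t * n.+1%:R)^-1 * (y + s * u) ^+ n.+1).
  by move=> u; apply: cvgM; [exact: cvg_cst|exact: continuous_affine_pow].
by move=> u; apply: cvgB; exact: cM.
Qed.

End polynomial_integrals.

(** * The two mixtures *)

Section unit_square.
Context (R : realType).
Notation mu := (@lebesgue_measure R).
Local Notation unif := (uniform_prob (@ltr01 R)).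
Local Notation U := (measurableTypeR R).

Lemma integral_unif (f : U -> \bar R) : measurable_fun setT f ->
  (forall x, 0 <= f x) -> \int[unif]_u f u = \int[mu]_(u in `[0%R, 1%R]) f u.
Proof. by move=> mf f0; rewrite integral_uniform// subr0 invr1 mul1e. Qed.

Lemma integral_unif2 (f : U * U -> \bar R) : measurable_fun setT f ->
  (forall w, 0 <= f w) -> \int[unif \x unif]_w f w =
    \int[mu]_(u in `[0%R, 1%R]) \int[mu]_(v in `[0%R, 1%R]) f (u, v).
Proof.
move=> mf f0; rewrite fubini_tonelli1// integral_unif; first last.
- by move=> u; exact: integral_ge0.
- exact: measurable_fun_fubini_tonelli_F.
apply: eq_integral => u _; rewrite /fubini_F integral_unif//.
exact: (measurableT_comp mf (pair1_measurable u)).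
Qed.

(** Parameters range over all reals, but the branches stay in the box only over the unit square;
    clamping makes every branch law have monotone cut points. *)
Definition clamp (u : R) : R := Num.max 0%R (Num.min 1%R u).

Lemma measurable_clamp : measurable_fun setT clamp.
Proof. by apply: measurable_maxr => //; exact: measurable_minr. Qed.

Lemma clamp01 u : (0 <= clamp u <= 1)%R.
Proof. by rewrite /clamp le_max lexx ge_max ler01 ge_min lexx. Qed.

Lemma clamp_id u : (0 <= u <= 1)%R -> clamp u = u.
Proof. by move=> /andP[u0 u1]; rewrite /clamp min_r// max_r. Qed.

End unit_square.

(* The weights of {0, 1, 2, 3} with generating polynomial
   [(1 + z + z^2 + z^3) / 4 + (z - 1) (a + b z + c z^2) / 16],
   given by their cumulative sums. *)
Section weights.
Local Open Scope ring_scope.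
Context (R : realType).
Implicit Types p : R * R * R.

Definition cutpoints p (k : nat) : R :=
  match k with
  | 0%N => 0
  | 1%N => 4^-1 - p.1.1 / 16
  | 2%N => 2^-1 - p.1.2 / 16
  | 3%N => 3 / 4 - p.2 / 16
  | _ => 1
  end.

Definition in_box p := [/\ 0 <= p.1.1 <= 1, 0 <= p.1.2 <= 2 & 0 <= p.2 <= 1].

(** In the box every increment differs from 1/4 by at most 2/16. *)
Lemma is_cuts_cutpoints p : in_box p -> is_cuts 4 (cutpoints p).
Proof.
move=> [/andP[a0 a1] /andP[b0 b1] /andP[c0 c1]]; split => //.
apply: homo_leq => [x|y x z|] //; first exact: le_trans.
by move=> [|[|[|[|k]]]]; rewrite /cutpoints; lra.
Qed.

Lemma genfun_cutpoints p (z : R) :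
  \sum_(k < 4) (cutpoints p k.+1 - cutpoints p k) * z ^+ k =
  (1 + z + z ^+ 2 + z ^+ 3) / 4 + (z - 1) / 16 * p.1.1 +
  (z - 1) * z / 16 * p.1.2 + (z - 1) * z ^+ 2 / 16 * p.2.
Proof. by rewrite !big_ord_recr big_ord0 /=; field. Qed.

End weights.

(** * Mixtures of four parametrized branches *)

Section mixtures.
Context (R : realType).
Notation mu := (@lebesgue_measure R).
Local Notation unif := (uniform_prob (@ltr01 R)).
Local Notation U := (measurableTypeR R).
Context (br : nat -> U * U -> R * R * R).
Hypothesis mbr : forall i, measurable_fun setT (br i).
Hypothesis brP : forall i u v, (0 <= u <= 1)%R -> (0 <= v <= 1)%R ->
  in_box (br i (u, v)).

Definition branch_law i (w : U * U) : PR R :=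
  digit_law 4 (cutpoints (br i (clamp w.1, clamp w.2))).

Let is_cuts_branch i w : is_cuts 4 (cutpoints (br i (clamp w.1, clamp w.2))).
Proof. by apply/is_cuts_cutpoints/brP; exact: clamp01. Qed.

Let measurable_branch_law i : measurable_fun setT (branch_law i).
Proof.
have mcl : measurable_fun setT (fun w : U * U => br i (clamp w.1, clamp w.2)).
  apply: (measurableT_comp (mbr i)); apply/measurable_fun_pairP; split.
    exact: (measurableT_comp (@measurable_clamp R) measurable_fst).
  exact: (measurableT_comp (@measurable_clamp R) measurable_snd).
apply: measurable_digit_law => -[|[|[|[|k]]]] //=; apply: measurable_funB => //;
  apply: measurable_funM => //.
- exact: (measurableT_comp measurable_fst (measurableT_comp measurable_fst mcl)).
- exact: (measurableT_comp measurable_snd (measurableT_comp measurable_fst mcl)).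
- exact: (measurableT_comp measurable_snd mcl).
Qed.

Definition branch_mfun i : {mfun (U * U)%type >-> PR R} :=
  HB.pack (branch_law i) (isMeasurableFun.Build _ _ _ _ _ (measurable_branch_law i)).

Definition mixture : PPR R :=
  average4 (fun i => distribution (unif \x unif : probability _ _) (branch_mfun i)).

Lemma mixtureE A : mixture A =
  (4^-1)%:E * \sum_(i < 4) (unif \x unif) (branch_law i @^-1` A).
Proof. by []. Qed.

Lemma mixture_full : mixture (supported_in (@naturals R 4)) = 1.
Proof.
rewrite mixtureE (eq_bigr (fun=> 1)).
  by rewrite sumEFin -EFinM sumr_const card_ord mulVf.
move=> i _; rewrite (_ : _ @^-1` _ = setT).
  exact: probability_setT.
by apply/seteqP; split => // w _; exact: digit_law_naturals.
Qed.

(** The [n]-th moment of the generating polynomial at [z] under branch [i]. *)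
Definition branch_moment (z : R) n i : \bar R :=
  \int[mu]_(u in `[0%R, 1%R]) \int[mu]_(v in `[0%R, 1%R])
    (((1 + z + z ^+ 2 + z ^+ 3) / 4 + (z - 1) / 16 * (br i (u, v)).1.1 +
      (z - 1) * z / 16 * (br i (u, v)).1.2 +
      (z - 1) * z ^+ 2 / 16 * (br i (u, v)).2) ^+ n)%:E.

Lemma integral_mixture_genfun (z : R) n : (0 <= z)%R ->
  \int[mixture]_θ ((\sum_(k < 4) (cum θ k.+1 - cum θ k) * z ^+ k) ^+ n)%:E =
  (4^-1)%:E * \sum_(i < 4) branch_moment z n i.
Proof.
move=> z0.
pose f (θ : PR R) := ((\sum_(k < 4) (cum θ k.+1 - cum θ k) * z ^+ k) ^+ n)%:E.
have mf : measurable_fun setT f.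
  apply/measurable_EFinP/measurable_funX/measurable_sum => k.
  by apply: measurable_funM => //; apply: measurable_funB; exact: measurable_cum.
have f0 θ : 0 <= f θ.
  rewrite lee_fin exprn_ge0// sumr_ge0// => k _.
  by rewrite mulr_ge0 ?exprn_ge0// subr_ge0 cum_homo.
rewrite ge0_integral_average4//; congr (_ * _); apply: eq_bigr => i _.
have mg : measurable_fun setT (f \o branch_law i).
  exact: (measurableT_comp mf (measurable_branch_law i)).
transitivity (\int[unif \x unif]_w (f \o branch_law i) w).
  exact: (@ge0_integral_distribution _ _ _ _ _ _ (branch_mfun i) f).
rewrite (integral_unif2 mg) => [|w]; last exact: f0.
apply: eq_integral => u; rewrite inE/= in_itv/= => u01.
apply: eq_integral => v; rewrite inE/= in_itv/= => v01.
rewrite /f /= -genfun_cutpoints; congr (_ ^+ _)%:E; apply: eq_bigr => k _.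
by rewrite !cum_digit_law// ?(ltnW (ltn_ord k))//= !clamp_id.
Qed.

End mixtures.

Section branches.
Context (R : realType).
Notation mu := (@lebesgue_measure R).
Local Notation unif := (uniform_prob (@ltr01 R)).
Local Notation U := (measurableTypeR R).

(** The default case covers both 2 and 3, which gives this branch weight 1/2 in the average of
    four. *)
Definition branches1 (i : nat) (w : U * U) : R * R * R :=
  match i with
  | 0%N => (0, w.1 + w.2, 0)%R
  | 1%N => (1, w.1 + w.2, 1)%R
  | _ => (w.1 : R, 1, w.2 : R)%R
  end.

Definition branches2 (i : nat) (w : U * U) : R * R * R :=
  match i with
  | 0%N => (0, w.1 + w.2, 1)%R
  | 1%N => (1, w.1 + w.2, 0)%R
  | 2%N => (w.1 : R, 0, w.2 : R)%R
  | _ => (w.1 : R, 2, w.2 : R)%R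
  end.

Let measurable_triple (f g h : U * U -> R) : measurable_fun setT f ->
  measurable_fun setT g -> measurable_fun setT h ->
  measurable_fun setT (fun w => (f w, g w, h w)).
Proof.
move=> mf mg mh; apply/measurable_fun_pairP; split => //.
by apply/measurable_fun_pairP; split.
Qed.

Let m1 : measurable_fun setT (fun w : U * U => (w.1 : R)).
Proof. exact: measurable_fst. Qed.

Let m2 : measurable_fun setT (fun w : U * U => (w.2 : R)).
Proof. exact: measurable_snd. Qed.

Lemma measurable_branches1 i : measurable_fun setT (branches1 i).
Proof.
case: i => [|[|i]]; apply: measurable_triple => //; exact: measurable_funD.
Qed.

Lemma measurable_branches2 i : measurable_fun setT (branches2 i).
Proof.
case: i => [|[|[|i]]]; apply: measurable_triple => //; exact: measurable_funD.
Qed.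

Lemma branches1_in_box i (u v : R) : (0 <= u <= 1)%R -> (0 <= v <= 1)%R ->
  in_box (branches1 i (u, v)).
Proof.
by move=> /andP[u0 u1] /andP[v0 v1]; case: i => [|[|i]];
  split; rewrite /=; apply/andP; split; lra.
Qed.

Lemma branches2_in_box i (u v : R) : (0 <= u <= 1)%R -> (0 <= v <= 1)%R ->
  in_box (branches2 i (u, v)).
Proof.
by move=> /andP[u0 u1] /andP[v0 v1]; case: i => [|[|[|i]]];
  split; rewrite /=; apply/andP; split; lra.
Qed.

Definition mixture1 := mixture measurable_branches1.
Definition mixture2 := mixture measurable_branches2.

End branches.

(** * Second differences and equality of the moments *)

Section second_differences.
Local Open Scope ring_scope.
Context (R : realType).

(* The mixed second difference of [G] with steps [s] and [t]: up to the factor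
   [s * t], the mean of [G''] over [x + [0, s] + [0, t]]. *)
Definition diff2 (G : R -> R) x s t := G (x + s + t) - G (x + s) - G (x + t) + G x.

(** With [A], [B], [C] the commuting shifts by [a], [b], [c], the terms with steps [b], [b] differ
    by [(B - 1)^2 (1 + A C - A - C)] and the others by [(A - 1) (C - 1) (2 B - 1 - B^2)]. These are
    [(B - 1)^2 (A - 1) (C - 1)] and its negative. *)
Lemma diff2_balance (G : R -> R) (e a b c : R) :
  diff2 G e b b + diff2 G (e + a + c) b b + diff2 G (e + b) a c + diff2 G (e + b) a c =
  diff2 G (e + c) b b + diff2 G (e + a) b b +
  diff2 G e a c + diff2 G (e + b + b) a c.
Proof.
(* Equal arguments of [G] are brought to one form, since [ring] treats the values of [G] as
   atoms. *)
rewrite /diff2 (_ : e + b + a = e + a + b); last by ring.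
rewrite (_ : e + b + c = e + c + b); last by ring.
rewrite (_ : e + a + b + c = e + a + c + b); last by ring.
rewrite (_ : e + b + b + a = e + a + b + b); last by ring.
rewrite (_ : e + b + b + c = e + c + b + b); last by ring.
rewrite (_ : e + a + b + b + c = e + a + c + b + b); last by ring.
ring.
Qed.

End second_differences.

Section moments.
Local Open Scope ring_scope.
Context (R : realType).
Notation mu := (@lebesgue_measure R).

Lemma branch_momentE (br : nat -> R * R -> R * R * R) (z x s t : R) n i :
  s != 0 -> t != 0 ->
  (forall u v, (1 + z + z ^+ 2 + z ^+ 3) / 4 + (z - 1) / 16 * (br i (u, v)).1.1 +
     (z - 1) * z / 16 * (br i (u, v)).1.2 +
     (z - 1) * z ^+ 2 / 16 * (br i (u, v)).2 = x + s * u + t * v) ->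
  (branch_moment br z n i =
   (diff2 (fun y => y ^+ n.+2) x s t / (s * t * (n.+1%:R * n.+2%:R)))%:E)%E.
Proof.
move=> s0 t0 brE; rewrite -(integral_affine_pow2 x n s0 t0).
by apply: eq_integral => u _; apply: eq_integral => v _; rewrite brE.
Qed.

Lemma sum4 (K : nat -> \bar R) :
  (\sum_(i < 4) K i = K 0%N + K 1%N + K 2%N + K 3%N)%E.
Proof. by rewrite !big_ord_recr big_ord0 /= add0e. Qed.

(* With [a], [b], [c] the coefficients of the three coordinates, [b * b = a * c]:
   both sides are integrals of [G''] for the same [G], and [diff2_balance] applies. *)
Lemma sum_branch_moment_eq (z : R) n : 1 < z ->
  (\sum_(i < 4) branch_moment (@branches1 R) z n i =
   \sum_(i < 4) branch_moment (@branches2 R) z n i)%E.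
Proof.
move=> z1.
pose e := (1 + z + z ^+ 2 + z ^+ 3) / 4.
pose a := (z - 1) / 16; pose b := (z - 1) * z / 16; pose c := (z - 1) * z ^+ 2 / 16.
have a0 : a != 0 by rewrite /a; apply/eqP; lra.
have b0 : b != 0 by rewrite /b !mulf_neq0 ?invr_neq0//; apply/eqP; lra.
have c0 : c != 0 by rewrite /c !mulf_neq0 ?invr_neq0 ?expf_neq0//; apply/eqP; lra.
have bb : b * b = a * c by rewrite /a /b /c; field.
rewrite [LHS](sum4 (branch_moment (@branches1 R) z n)).
rewrite [RHS](sum4 (branch_moment (@branches2 R) z n)).
(* Base point and steps are read off each branch: a middle coordinate [u + v] gives two steps [b],
   free outer coordinates give the steps [a] and [c]. *)
rewrite (@branch_momentE (@branches1 R) z e b b n 0%N b0 b0); last first.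
  by move=> u v; rewrite -/e -/a -/b -/c /=; ring.
rewrite (@branch_momentE (@branches1 R) z (e + a + c) b b n 1%N b0 b0); last first.
  by move=> u v; rewrite -/e -/a -/b -/c /=; ring.
rewrite (@branch_momentE (@branches1 R) z (e + b) a c n 2%N a0 c0); last first.
  by move=> u v; rewrite -/e -/a -/b -/c /=; ring.
rewrite (@branch_momentE (@branches1 R) z (e + b) a c n 3%N a0 c0); last first.
  by move=> u v; rewrite -/e -/a -/b -/c /=; ring.
rewrite (@branch_momentE (@branches2 R) z (e + c) b b n 0%N b0 b0); last first.
  by move=> u v; rewrite -/e -/a -/b -/c /=; ring.
rewrite (@branch_momentE (@branches2 R) z (e + a) b b n 1%N b0 b0); last first.
  by move=> u v; rewrite -/e -/a -/b -/c /=; ring.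
rewrite (@branch_momentE (@branches2 R) z e a c n 2%N a0 c0); last first.
  by move=> u v; rewrite -/e -/a -/b -/c /=; ring.
rewrite (@branch_momentE (@branches2 R) z (e + b + b) a c n 3%N a0 c0); last first.
  by move=> u v; rewrite -/e -/a -/b -/c /=; ring.
(* The cone relation [bb] gives all eight terms the same denominator. *)
rewrite -!EFinD bb -!mulrDl; congr (_ / _)%:E.
exact: diff2_balance.
Qed.

Lemma mixture_genfun_eq (z : R) n : 1 < z ->
  (\int[mixture1 R]_θ ((\sum_(k < 4) (cum θ k.+1 - cum θ k) * z ^+ k) ^+ n)%:E =
   \int[mixture2 R]_θ ((\sum_(k < 4) (cum θ k.+1 - cum θ k) * z ^+ k) ^+ n)%:E)%E.
Proof.
move=> z1; have z0 : 0 <= z by lra.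
have h1 := integral_mixture_genfun (@measurable_branches1 R) (@branches1_in_box R) n z0.
have h2 := integral_mixture_genfun (@measurable_branches2 R) (@branches2_in_box R) n z0.
by apply: (etrans h1); rewrite sum_branch_moment_eq//; exact/esym.
Qed.

(** At [z = 1] the generating polynomial is 1. Used to see that the partial sums carry full mass on
    finitely many naturals. *)
Lemma mixture_mass br (mbr : forall i, measurable_fun setT (br i)) n :
  (forall i (u v : R), 0 <= u <= 1 -> 0 <= v <= 1 -> in_box (br i (u, v))) ->
  (\int[mixture mbr]_θ ((\sum_(k < 4) (cum θ k.+1 - cum θ k) * 1 ^+ k) ^+ n)%:E = 1)%E.
Proof.
move=> brP; rewrite (integral_mixture_genfun mbr brP n ler01).
have int01 : (\int[mu]_(x in `[0%R, 1%R]) 1%:E = 1)%E.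
  by rewrite integral_cst//= lebesgue_measure_itv/= lte_fin ltr01 sube0 mule1.
have E i : branch_moment br 1 n i = 1%E.
  rewrite -[RHS]int01; apply: eq_integral => u _.
  rewrite -[RHS]int01; apply: eq_integral => v _.
  rewrite subrr !mul0r !addr0 !expr1n (_ : _ / 4 = 1); last by field.
  by rewrite expr1n.
rewrite (sum4 (branch_moment br 1 n)) !E.
by rewrite -!EFinD -EFinM; congr EFin; field.
Qed.

End moments.

(** * A set of laws charged by only one of the mixtures *)

Section separation.
Context (R : realType).
Local Notation unif := (uniform_prob (@ltr01 R)).
Local Notation U := (measurableTypeR R).

(** For a law encoded by [(a, b, c)] this says [a = c = 0]. *)
Definition separator : set (PR R) :=
  [set θ | cum θ 1 = 4^-1%R /\ cum θ 3 = (3 / 4)%R].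

Lemma measurable_separator : measurable separator.
Proof.
have mc k (x : R) : measurable [set θ : PR R | cum θ k = x].
  have := @measurable_cum R k measurableT _ (measurable_set1 x).
  by rewrite setTI.
exact: (measurableI _ _ (mc 1%N _) (mc 3%N _)).
Qed.

Lemma branch_law_separator br i w :
  (forall i u v, (0 <= u <= 1)%R -> (0 <= v <= 1)%R -> in_box (br i (u, v))) ->
  separator (branch_law br i w) ->
  (br i (clamp w.1, clamp w.2)).1.1 = 0%R /\ (br i (clamp w.1, clamp w.2)).2 = 0%R.
Proof.
move=> brP; have hc := is_cuts_cutpoints (brP i _ _ (clamp01 w.1) (clamp01 w.2)).
rewrite /separator /= /branch_law !cum_digit_law//= => -[h1 h3].
by split; lra.
Qed.

(** Branch 0 always lies in [separator]. *)
Lemma mixture1_separator : mixture1 R separator != 0.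
Proof.
rewrite /mixture1 mixtureE.
rewrite (sum4 (fun i => (unif \x unif) (branch_law (@branches1 R) i @^-1` separator))).
rewrite (_ : _ 0%N @^-1` _ = setT); last first.
  apply/seteqP; split => // w _.
  have hc := is_cuts_cutpoints (branches1_in_box 0%N (clamp01 w.1) (clamp01 w.2)).
  by rewrite /separator /= /branch_law !cum_digit_law//= mul0r !subr0.
rewrite probability_setT gt_eqF// mule_gt0// ?lte_fin ?invr_gt0//.
apply: (lt_le_trans lte01).
by do 3!apply: (le_trans _ (leeDl _ (measure_ge0 _ _))).
Qed.

Lemma unif_le0 : unif `]-oo, 0%R]%classic = 0.
Proof.
rewrite unifE//; apply/eqP; rewrite -measure_le0 -(lebesgue_measure_set1 (0%R : R)).
apply: le_measure; rewrite ?inE//; first exact: measurableI.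
move=> x [/=]; rewrite !in_itv/= => x0 /andP[x0' _].
by apply/eqP; rewrite eq_le x0.
Qed.

(** Branches 0 and 1 have an outer coordinate 1 and never meet [separator]; the other two meet it
    only if the clamped [u] is 0, that is [u <= 0], a null event. *)
Lemma mixture2_separator : mixture2 R separator = 0.
Proof.
rewrite /mixture2 mixtureE big1 ?mule0// => -[i i4] _ /=.
apply/eqP; rewrite -measure_le0.
have <- : (unif \x unif) (`]-oo, 0%R]%classic `*` setT) = 0.
  apply: (etrans (product_measure1E _ _ _ _)) => //.
  by rewrite [X in X * _](unif_le0 : _ = _) mul0e.
apply: le_measure; rewrite ?inE//.
- by have /(_ setT measurableT _ measurable_separator) :=
    measurable_funP (branch_mfun (@measurable_branches2 R) i); rewrite setTI.
- exact: measurableX.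
move=> w /(branch_law_separator (@branches2_in_box R)) wA; split => //=.
rewrite in_itv/= leNgt; apply/negP => w0; move: wA.
have c0 : clamp w.1 != 0%R.
  by rewrite /clamp gt_eqF// lt_max lt_min w0 ltr01 orbT.
move: i4; case: i => [|[|[|i]]] _ /= []; [lra|lra| |];
  by move=> /eqP; rewrite (negbTE c0).
Qed.

End separation.

(** * Equal laws of all partial sums for two different mixtures *)

Lemma F0123_naturals (R : realType) : F0123 R = supported_in (@naturals R 4).
Proof.
rewrite /F0123; congr supported_in.
by rewrite /naturals !big_ord_recr big_ord0/= set0U.
Qed.

Theorem theorem2p3p2 (R : realType) : ~ good (F0123 R).
Proof.
move=> good_F.
have full1 := mixture_full (@measurable_branches1 R) (@branches1_in_box R).
have full2 := mixture_full (@measurable_branches2 R) (@branches2_in_box R).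
have := good_F (mixture1 R) (mixture2 R).
rewrite F0123_naturals => /(_ full1 full2).
move=> /(_ _ _ _ _ _ _ _ _ (iid_mixture_digits full1) (iid_mixture_digits full2)).
have sums n (B : set R) : measurable B ->
    distribution (mixture1 R \x uniform_prob (@ltr01 R) : probability _ _)
      (sum_digit_rv R 4 n) B =
    distribution (mixture2 R \x uniform_prob (@ltr01 R) : probability _ _)
      (sum_digit_rv R 4 n) B.
  (* A sum of [n] digits from 0 to 3 is at most [n * 3]. The two mass conditions are the case
     [z = 1] of the generating function identity. *)
  apply: (@prob_genfun_inj _ _ _ (n * 3).+1).
  - apply: etrans _ (mixture_mass (@measurable_branches1 R) n (@branches1_in_box R)).
    apply: etrans _ (genfun_sum_digit_rv full1 ler01 (ltnSn _)).
    by apply: eq_bigr => m _; rewrite expr1n mul1e.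
  - apply: etrans _ (mixture_mass (@measurable_branches2 R) n (@branches2_in_box R)).
    apply: etrans _ (genfun_sum_digit_rv full2 ler01 (ltnSn _)).
    by apply: eq_bigr => m _; rewrite expr1n mul1e.
  - move=> z z1; have z0 : (0 <= z)%R by rewrite ltW// (lt_trans _ z1).
    apply: etrans (genfun_sum_digit_rv full1 z0 (ltnSn _)) _.
    apply/esym; apply: etrans (genfun_sum_digit_rv full2 z0 (ltnSn _)) _.
    exact/esym/mixture_genfun_eq.
move=> /(_ (fun n _ B mB => sums n B mB)) /(_ _ (@measurable_separator R)) eq12.
by have := mixture1_separator R; rewrite eq12 mixture2_separator eqxx.
Qed.
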